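(* Let $T$ be a tree. Then $Z_{\pm}(T)=Z(T)$.
   Context: Classical zero forcing on a graph $G$: start with a set $S$ of black vertices, others white; repeatedly, if a black vertex has exactly one white neighbour, color that neighbour black. $S$ is a zero forcing set if eventually all vertices are black; $Z(G)$ is the minimum size of a zero forcing set. $Z_{\pm}(G)$ denotes $Z_{\pm}(P_{\mathcal{Z}}(G))$, where $P_{\mathcal{Z}}(G)$ is the sign pattern with $P_{ii}=?$, $P_{ij}=-$ if $i\sim j$, $P_{ij}=0$ otherwise. Signed zero forcing game on a sign pattern $P$ (entries in $\{+,-,0,?\}$): each vertex is black or white; a white vertex may carry a marker $m(w)\in\{+,-\}$ ($m(w)=*$ if unmarked; markers vanish when a vertex is colored black). Initially a set $S$ is black, others white and unmarked. Write $\iota(+)=-$, $\iota(-)=+$, $s\cdot t=+$ if $s=t$ and $-$ otherwise. A move: let $u$ be black, or white with $P_{uu}\neq ?$; let $W$ be the set of white $w$ (possibly $w=u$) with $P_{uw}\in\{+,-\}$; $W_+=\{w\in W: m(w)=P_{uw}\}$, $W_-=\{w\in W: m(w)\neq *, m(w)\neq P_{uw}\}$, $W_*=\{w\in W:m(w)=*\}$. (a) If $W=\{w\}$, color $w$ black. (b) If $W_+=W$ or $W_-=W$, color all of $W$ black. (c) If $W_s\neq\emptyset$, $W_{\iota(s)}=\emptyset$, $W_*=\{w\}$, mark $w$ with $P_{uw}\cdot\iota(s)$. (d) If no white vertex is marked, any white vertex may be marked $+$. $S$ is a signed zero forcing set if some sequence of moves makes everything black; $Z_{\pm}(P)$ is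 the minimum size of such a set. *)

(* Defs.v *)
From HB Require Import structures.
From mathcomp Require Import all_boot.

Set Implicit Arguments.
Unset Strict Implicit.
Unset Printing Implicit Defensive.

(* A finite simple graph is a symmetric irreflexive [e : rel V] on a finType. *)

Definition is_tree (V : finType) (e : rel V) : Prop :=
  [/\ 0 < #|V|,
      forall x y : V, connect e x y
    & forall c : seq V, 2 < size c -> ~ ucycle e c].

Section ZeroForcing.
Variables (V : finType) (e : rel V).

Definition white_nbrs (B : {set V}) (u : V) : {set V} :=
  [set w | e u w & w \notin B].

(* [B] is the set of black vertices. *)
Definition zf_step (B B' : {set V}) : bool :=
  [exists u in B, exists w,
     (white_nbrs B u == [set w]) && (B' == w |: B)].

Definition zf_set (S : {set V}) : bool := connect zf_step S setT.

(* The default [setT] is itself a zero forcing set, so the argmin is genuine. *)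
Definition Z : nat := #|[arg min_(S < [set: V] | zf_set S) #|S|]|.

End ZeroForcing.

Inductive sign := Pos | Neg.

Definition bool_of_sign (s : sign) : bool := if s is Pos then true else false.
Definition sign_of_bool (b : bool) : sign := if b then Pos else Neg.
Lemma bool_of_signK : cancel bool_of_sign sign_of_bool.
Proof. by case. Qed.
HB.instance Definition _ := Finite.copy sign (can_type bool_of_signK).

Definition iota_sign (s : sign) : sign := if s is Pos then Neg else Pos.
Definition sign_mul (s t : sign) : sign := if s == t then Pos else Neg.

Inductive entry := Zero | Unknown | Signed of sign.

Definition entry_sign (a : entry) : option sign :=
  if a is Signed s then Some s else None.
Definition is_unknown (a : entry) : bool := if a is Unknown then true else false.

(* [White None] is an unmarked white vertex; a black vertex has no marker. *)
Inductive vstate := Black | White of option sign.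

Definition option_of_vstate (x : vstate) : option (option sign) :=
  if x is White m then Some m else None.
Definition vstate_of_option (o : option (option sign)) : vstate :=
  if o is Some m then White m else Black.
Lemma option_of_vstateK : cancel option_of_vstate vstate_of_option.
Proof. by case. Qed.
HB.instance Definition _ := Finite.copy vstate (can_type option_of_vstateK).

Definition marker (x : vstate) : option sign := if x is White m then m else None.

Section SignedZeroForcing.
Variables (V : finType) (P : V -> V -> entry).

Definition config := {ffun V -> vstate}.
Implicit Types (c : config) (u w : V).

Definition init_config (S : {set V}) : config :=
  [ffun v => if v \in S then Black else White None].

Definition blacken c (A : {set V}) : config :=
  [ffun v => if v \in A then Black else c v].

Definition set_marker c w (s : sign) : config :=
  [ffun v => if v == w then White (Some s) else c v].

Definition can_act c u : bool := (c u == Black) || ~~ is_unknown (P u u).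

Definition W_all c u : {set V} :=
  [set w | c w != Black & entry_sign (P u w) != None].

(* On [W_all c u], [entry_sign (P u w)] is [Some] of the sign [P u w]. *)
Definition W_sign c u (s : sign) : {set V} :=
  match s with
  | Pos => [set w in W_all c u | marker (c w) == entry_sign (P u w)]
  | Neg => [set w in W_all c u | (marker (c w) != None) &&
                                 (marker (c w) != entry_sign (P u w))]
  end.

Definition W_star c u : {set V} :=
  [set w in W_all c u | marker (c w) == None].

Definition rule_a c u c' : bool :=
  [exists w, (W_all c u == [set w]) && (c' == blacken c [set w])].

Definition rule_b c u c' : bool :=
  ((W_sign c u Pos == W_all c u) || (W_sign c u Neg == W_all c u))
    && (c' == blacken c (W_all c u)).

Definition rule_c c u c' : bool :=
  [exists s : sign, exists w, exists p : sign,
     [&& W_sign c u s != set0, W_sign c u (iota_sign s) == set0,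
         W_star c u == [set w], entry_sign (P u w) == Some p
       & c' == set_marker c w (sign_mul p (iota_sign s))]].

Definition rule_d c c' : bool :=
  [forall v, marker (c v) == None] &&
  [exists w, (c w != Black) && (c' == set_marker c w Pos)].

Definition szf_step c c' : bool :=
  [exists u, can_act c u && [|| rule_a c u c', rule_b c u c' | rule_c c u c']]
    || rule_d c c'.

Definition szf_set (S : {set V}) : bool :=
  connect szf_step (init_config S) [ffun=> Black].

(* As for [Z], the default [setT] is a signed zero forcing set. *)
Definition Zpm_pattern : nat := #|[arg min_(S < [set: V] | szf_set S) #|S|]|.

End SignedZeroForcing.

Definition graph_pattern (V : finType) (e : rel V) (i j : V) : entry :=
  if i == j then Unknown else if e i j then Signed Neg else Zero.

Definition Zpm (V : finType) (e : rel V) : nat := Zpm_pattern (graph_pattern e).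

(* Main.v *)
Require Import Defs.
From mathcomp Require Import all_boot.

Set Implicit Arguments.
Unset Strict Implicit.
Unset Printing Implicit Defensive.

(** On a tree the marks never help: the zero forcing sets and the signed zero
    forcing sets coincide.  All marks derived from one guess (rule (d)) lie in a
    connected set [H], which grows by rule (c) along a path
    marked - black - marked - black - ...  Since there are no cycles, a vertex
    outside [H] has at most one neighbour in [H].  Hence a black vertex with two
    marked white neighbours lies in [H], and it got there by applying rule (c), so
    its only white neighbours are two oppositely marked ones and rule (b) does not
    apply to it.  So rule (b) can only fire on a single white neighbour, where it
    is the classical forcing rule. *)

(** * Connected subsets of acyclic graphs *)

Section ConnectedSubsets.
Variables (V : finType) (e : rel V).
Hypothesis e_sym : symmetric e.
Implicit Types (H : {set V}) (u v x y : V).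

Definition restrict_rel H : rel V := fun x y => [&& x \in H, y \in H & e x y].

Definition connected_in H := {in H &, forall x y, connect (restrict_rel H) x y}.

Lemma connected_in1 v : connected_in [set v].
Proof. by move=> x y /set1P-> /set1P->; apply: connect0. Qed.

Lemma connected_inU1 H x u :
  connected_in H -> x \in H -> e x u -> connected_in (u |: H).
Proof.
move=> Hconn xH exu.
have sub y z : connect (restrict_rel H) y z -> connect (restrict_rel (u |: H)) y z.
  apply: connect_sub => a b /and3P[aH bH eab]; apply: connect1.
  by rewrite /restrict_rel !in_setU1 aH bH eab !orbT.
have [xu ux] : connect (restrict_rel (u |: H)) x u
            /\ connect (restrict_rel (u |: H)) u x.
  by split; apply: connect1; rewrite /restrict_rel !in_setU1 xH eqxx orbT //= e_sym.
move=> y z /setU1P[->|yH] /setU1P[->|zH] //.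
- by apply: connect_trans ux (sub _ _ (Hconn _ _ xH zH)).
- by apply: connect_trans (sub _ _ (Hconn _ _ yH xH)) xu.
- exact/sub/Hconn.
Qed.

(** Otherwise a simple path from [x] to [y] inside [H], closed up through [u], would be a cycle of
    length at least 3. *)
Lemma acyclic_nbr_uniq H u x y :
    (forall c : seq V, 2 < size c -> ~ ucycle e c) -> connected_in H ->
  u \notin H -> x \in H -> y \in H -> e u x -> e u y -> x = y.
Proof.
move=> acyc Hconn uH xH yH eux euy; apply/eqP/negPn/negP => neq_xy.
case/connectP: (Hconn _ _ xH yH) => p0 /shortenP[p p_path p_uniq _] y_last.
have pH : all (mem H) p.
  elim: p x {p_uniq eux neq_xy xH y_last} p_path => //= z p IHp x.
  by case/andP=> /and3P[_ -> _] /IHp.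
have e_path : path e x p.
  by apply: sub_path p_path => a b /and3P[].
case: p => [|z p] in p_path p_uniq y_last pH e_path *.
  by rewrite y_last eqxx in neq_xy.
apply: (acyc [:: u, x, z & p]) => //; apply/andP; split.
  move: y_last e_path => /= y_last /andP[-> e_path].
  by rewrite eux rcons_path e_path -y_last e_sym euy.
rewrite cons_uniq p_uniq andbT; apply: contra uH.
by rewrite inE => /predU1P[->//|/(allP pH)].
Qed.

End ConnectedSubsets.

(** * The signed game on the pattern of a graph *)

Section SignedForcing.
Variables (V : finType) (e : rel V).
Hypotheses (e_sym : symmetric e) (e_irr : irreflexive e).
Implicit Types (c : config V) (B H : {set V}) (u v w x y : V).

Local Notation P := (graph_pattern e).

Definition black_set c : {set V} := [set v | c v == Black].

Lemma entry_sign_graph u w : entry_sign (P u w) = if e u w then Some Neg else None.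
Proof. by rewrite /graph_pattern; case: eqP => [->|_]; rewrite ?e_irr; case: (e u w). Qed.

Lemma W_all_graph c u : W_all P c u = white_nbrs e (black_set c) u.
Proof.
by apply/setP=> w; rewrite !inE entry_sign_graph andbC; case: (e u w).
Qed.

Lemma mem_W_all c u w : (w \in W_all P c u) = e u w && (c w != Black).
Proof. by rewrite W_all_graph !inE. Qed.

Lemma can_act_graph c u : can_act P c u = (c u == Black).
Proof. by rewrite /can_act /graph_pattern eqxx orbF. Qed.

Lemma white_marked v c : marker (c v) != None -> c v != Black.
Proof. by case: (c v). Qed.

(** Every edge has entry [Neg], so agreement ([s = Pos]) means the marker [Neg] and disagreement the
    marker [Pos]. *)
Lemma mem_W_sign c u s w :
  (w \in W_sign P c u s) = e u w && (marker (c w) == Some (iota_sign s)).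
Proof.
case: s; rewrite !inE entry_sign_graph; case: (e u w); rewrite ?andbF //= ?andbT;
  by case: (c w) => [|[[]|]].
Qed.

Lemma mem_W_star c u w : (w \in W_star P c u) = e u w && (c w == White None).
Proof. by rewrite inE mem_W_all -andbA; case: (c w) => [|[[]|]]; rewrite ?andbF. Qed.

Lemma black_blacken c (A : {set V}) : black_set (blacken c A) = A :|: black_set c.
Proof. by apply/setP=> v; rewrite !inE ffunE; case: ifP. Qed.

Lemma black_set_marker c w s : c w != Black ->
  black_set (set_marker c w s) = black_set c.
Proof. by move=> cw; apply/setP=> v; rewrite !inE ffunE; case: ifP => // /eqP->; case: (c w) cw. Qed.

Lemma black_init B : black_set (init_config B) = B.
Proof. by apply/setP=> v; rewrite !inE ffunE; case: ifP. Qed.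

(** A classical force is an instance of rule (a), which leads from one [init_config] to another. *)
Lemma zf_set_szf_set B : zf_set e B -> szf_set P B.
Proof.
rewrite /zf_set /szf_set; case/connectP=> p.
elim: p B => [|B' p IHp] B /=.
  move=> _ <-; rewrite (_ : init_config _ = [ffun=> Black]) //.
  by apply/ffunP=> v; rewrite !ffunE inE.
case/andP=> /exists_inP[u uB /existsP[w /andP[Wu /eqP defB']]] /IHp{}IHp /IHp.
apply: connect_trans; apply: connect1; apply/orP; left.
apply/existsP; exists u; rewrite can_act_graph ffunE uB /=; apply/orP; left.
apply/existsP; exists w; rewrite W_all_graph black_init Wu defB'.
by apply/eqP/ffunP=> v; rewrite !ffunE !inE; case: eqP.
Qed.

(** * Supports of marks and their evolution under the moves *)

(* [H] contains the traces of all marks placed since the last use of rule (d);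
   its black vertices are those that propagated a mark and the marked vertices
   that have since been blackened. *)
Record mark_support c H : Prop := MarkSupport {
  support_conn : connected_in e H;
  marked_support : forall v, marker (c v) != None -> v \in H;
  support_white : {in H &, forall x y, c x != Black -> c y != Black -> ~~ e x y};
  support_black : forall u x y s, u \in H -> c u = Black -> e u x -> e u y -> x != y ->
    marker (c x) = Some s -> c y != Black -> marker (c y) = Some (iota_sign s) }.

Lemma mark_support_init B : mark_support (init_config B) set0.
Proof.
split=> [x y|v|x y|u x y s]; rewrite ?inE //.
by rewrite ffunE; case: ifP.
Qed.

Lemma mark_support_blacken c (A : {set V}) H :
  mark_support c H -> mark_support (blacken c A) H.
Proof.
case=> Hconn Hmark Hwhite Hblack.
split=> // [v|x y xH yH|u x y s uH].
- by rewrite ffunE; case: ifP => // _ /Hmark.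
- by rewrite !ffunE; case: ifP => // _; case: ifP => // _; apply: Hwhite.
rewrite !ffunE => cu eux euy neq_xy; case: ifP => // _ cx; case: ifP => // _ cy.
have cx' : marker (c x) != None by rewrite cx.
case cuB: (c u == Black).
  exact: (Hblack u x y s uH (eqP cuB) eux euy neq_xy cx cy).
(* Here [u] has only just been blackened: while white in [H] it could have no marked neighbour. *)
have := Hwhite u x uH (Hmark _ cx') (negbT cuB) (white_marked cx').
by rewrite eux.
Qed.

(** With no marks left, the former support is dropped and a new one starts at the guessed vertex. *)
Lemma mark_support_guess c v s :
  (forall x, marker (c x) = None) -> mark_support (set_marker c v s) [set v].
Proof.
move=> nomark; split=> [|x|x y /set1P-> /set1P->|u x y t /set1P-> /eqP].
- exact: connected_in1.
- by rewrite ffunE inE; case: ifP; rewrite ?nomark.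
- by rewrite e_irr.
- by rewrite ffunE eqxx.
Qed.

Hypothesis e_acyclic : forall s : seq V, 2 < size s -> ~ ucycle e s.

(** Rule (c) attaches the branch [x - u - y] to [H]. By acyclicity [u] meets [H] only in [x], and
    [y] meets [u |: H] only in [u]. *)
Lemma mark_support_propagate c H u x y s :
    mark_support c H -> c u = Black -> e u x -> e u y ->
    marker (c x) = Some s -> c y = White None ->
    (forall z, e u z -> c z != Black -> z != y -> marker (c z) = Some s) ->
  mark_support (set_marker c y (iota_sign s)) (y |: (u |: H)).
Proof.
case=> Hconn Hmark Hwhite Hblack cu eux euy cx cy others.
have xH : x \in H by apply: Hmark; rewrite cx.
have neq_xy : x != y by apply: contra_eqN cx => /eqP->; rewrite cy.
(* If [u] were in [H], the mark on [x] would already force one on [y]. *)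
have uH : u \notin H.
  apply/negP=> uH; have := Hblack u x y s uH cu eux euy neq_xy cx.
  by rewrite cy => /(_ isT).
have yH : y \notin H.
  apply: contraNN neq_xy => yH; apply/eqP.
  exact: (acyclic_nbr_uniq e_sym e_acyclic Hconn uH).
have neq_uy : u != y by apply: contraTneq euy => ->; rewrite e_irr.
have exu : e x u by rewrite e_sym.
have Hconn1 := connected_inU1 e_sym Hconn xH exu.
have uH1 : u \in u |: H by rewrite setU11.
have yH1 : y \notin u |: H by rewrite in_setU1 eq_sym negb_or neq_uy.
have y_nbr z : z \in u |: H -> e y z -> z = u.
  move=> zH eyz; apply: (acyclic_nbr_uniq e_sym e_acyclic Hconn1 yH1) => //.
  by rewrite e_sym.
have u_nbr z : e u z -> c z != Black -> z = x \/ z = y.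
  move=> euz cz; case: (eqVneq z y) => [->|neq_zy]; first by right.
  left; apply: (acyclic_nbr_uniq e_sym e_acyclic Hconn uH) => //.
  by apply: Hmark; rewrite (others z).
have mark z : set_marker c y (iota_sign s) z != Black = (c z != Black).
  by rewrite ffunE; case: ifP => // /eqP->; rewrite cy.
split=> [|v|v w|v w z t].
- exact: (connected_inU1 e_sym Hconn1 uH1 euy).
- rewrite ffunE !in_setU1; case: ifP => //= _ /Hmark->.
  by rewrite orbT.
- rewrite !mark => /setU1P[->|vH] /setU1P[->|wH] cv cw; first by rewrite e_irr.
  + by apply: contraNN cw => /(y_nbr _ wH)->; rewrite cu.
  + by rewrite e_sym; apply: contraNN cv => /(y_nbr _ vH)->; rewrite cu.
  case/setU1P: vH cv => [->|vH cv]; first by rewrite cu.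
  case/setU1P: wH cw => [->|wH cw]; first by rewrite cu.
  exact: Hwhite.
rewrite mark => vH cv evw evz neq_wz cw cz.
have cvB : c v = Black by apply/eqP/negPn; rewrite -mark cv.
have cwB : c w != Black by rewrite -mark; apply: white_marked; rewrite cw.
case/setU1P: vH => [v_y|vH]; first by rewrite v_y cy in cvB.
have{} vH : v = u \/ v \in H by case/setU1P: vH; [left | right].
case: vH => [v_u|vH].
  (* At the new black vertex [u] the white neighbours are [x] and [y], marked [s] and
     [iota_sign s]. *)
  rewrite v_u in evw evz; move: neq_wz cw.
  case: (u_nbr w evw cwB) => ->; case: (u_nbr z evz cz) => -> //; rewrite ?eqxx //.
  - by rewrite !ffunE eqxx (negPf neq_xy) cx => _ [->].
  - by rewrite !ffunE eqxx (negPf neq_xy) cx => _ [<-]; case: (s).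
(* Older black vertices of [H] are not adjacent to [y], so they do not see the new mark. *)
have not_y a : e v a -> a != y.
  apply: contraTneq => ->; rewrite e_sym; apply/negP => eyv; move: uH.
  by rewrite -(y_nbr v) ?vH // in_setU1 vH orbT.
move: cw; rewrite !ffunE (negPf (not_y w evw)) (negPf (not_y z evz)) => cw.
exact: (Hblack v w z t).
Qed.

(** Outside [H], [u] has at most one neighbour in [H]; inside, [support_black] makes the two marks
    opposite. This confines rule (b) to one vertex. *)
Lemma mark_support_nbr_uniq c H u x y s :
    mark_support c H -> c u = Black -> e u x -> e u y ->
  marker (c x) = Some s -> marker (c y) = Some s -> x = y.
Proof.
case=> Hconn Hmark Hwhite Hblack cu eux euy cx cy.
have [uH|uH] := boolP (u \in H); last first.
  by apply: (acyclic_nbr_uniq e_sym e_acyclic Hconn uH) => //; apply: Hmark;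
    rewrite ?cx ?cy.
apply/eqP/negPn/negP => neq_xy.
have cyB : c y != Black by apply: white_marked; rewrite cy.
by have := Hblack u x y s uH cu eux euy neq_xy cx cyB; rewrite cy; case: (s).
Qed.

Lemma szf_step_zf c c' H : mark_support c H -> szf_step P c c' ->
  (exists H', mark_support c' H') /\ connect (zf_step e) (black_set c) (black_set c').
Proof.
move=> supp; have force u w : c u == Black -> W_all P c u = [set w] ->
    zf_step e (black_set c) (black_set (blacken c [set w])).
  move=> cu Wu; apply/exists_inP; exists u; first by rewrite inE.
  by apply/existsP; exists w; rewrite -W_all_graph Wu eqxx black_blacken eqxx.
case/orP=> [/existsP[u]|]; last first.
  case/andP=> /forallP nomark /existsP[v /andP[cv /eqP->]]; split.
    by exists [set v]; apply: mark_support_guess => x; apply/eqP/nomark.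
  by rewrite black_set_marker.
rewrite can_act_graph => /andP[cu /or3P[]].
- case/existsP=> w /andP[/eqP Wu /eqP->]; split.
    by exists H; apply: mark_support_blacken.
  exact/connect1/(force u).
- case/andP=> same /eqP->; split; first by exists H; apply: mark_support_blacken.
  have [s Ws] : exists s, W_sign P c u s = W_all P c u.
    by case/orP: same => /eqP; [exists Pos | exists Neg].
  (* Rule (b) may fire with no white neighbour at all; the black set is then unchanged. *)
  have [W0|[w wW]] := set_0Vmem (W_all P c u).
    by rewrite black_blacken W0 set0U connect0.
  have Wmark x : x \in W_all P c u -> e u x /\ marker (c x) = Some (iota_sign s).
    by rewrite -Ws mem_W_sign => /andP[-> /eqP].
  have W1 : W_all P c u = [set w].
    apply/setP=> x; rewrite inE; apply/idP/eqP => [xW|-> //].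
    have [[eux cx] [euw cw]] := (Wmark x xW, Wmark w wW).
    exact: (mark_support_nbr_uniq supp (eqP cu) eux euw cx cw).
  by rewrite W1; apply/connect1/(force u).
case/existsP=> s /existsP[y /existsP[p /and5P[Ws Wi /eqP Wst pE /eqP->]]].
have /andP[euy /eqP cy] : e u y && (c y == White None).
  by rewrite -mem_W_star Wst set11.
case/set0Pn: Ws => x; rewrite mem_W_sign => /andP[eux /eqP cx].
(* Multiplying by the edge sign [Neg] is [iota_sign], so [y] gets the mark opposite to that of
   [x]. *)
have -> : sign_mul p (iota_sign s) = iota_sign (iota_sign s).
  by move: pE; rewrite entry_sign_graph euy => /eqP[<-]; case: (s).
split; last by rewrite black_set_marker ?cy.
exists (y |: (u |: H)); apply: (mark_support_propagate supp (eqP cu) eux euy cx cy).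
move=> z euz cz neq_zy.
have : z \notin W_sign P c u (iota_sign s) by rewrite (eqP Wi) inE.
have : z \notin W_star P c u by rewrite Wst inE.
by rewrite mem_W_star mem_W_sign euz /=; case: (c z) cz => [|[[]|]]; case: (s).
Qed.

(** Induction along the moves, for any configuration with a support, since both change at each
    move. *)
Lemma szf_set_zf_set B : szf_set P B -> zf_set e B.
Proof.
rewrite /szf_set /zf_set -{2}[B]black_init.
have := mark_support_init B.
move: (init_config B) set0 => c H supp /connectP[p].
elim: p c H supp => [|c' p IHp] c H supp /=.
  move=> _ <-; rewrite (_ : black_set _ = setT) //.
  by apply/setP=> v; rewrite !inE ffunE.
case/andP=> /(szf_step_zf supp)[[H' supp'] cc'] /(IHp _ _ supp'){}IHp /IHp.
exact: connect_trans.
Qed.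

End SignedForcing.

Theorem mainTheorem4 (V : finType) (e : rel V)
    (e_sym : symmetric e) (e_irr : irreflexive e) (e_tree : is_tree e) :
  Zpm e = Z e.
Proof.
have [_ _ e_acyclic] := e_tree.
have zfT : zf_set e setT by apply: connect0.
have szfT := zf_set_szf_set e_irr zfT.
rewrite /Zpm /Zpm_pattern /Z.
(* Each minimiser lies in the other family, so the two minima bound each other. *)
case: arg_minnP => // S S_szf S_min; case: arg_minnP => // S' S'_zf S'_min.
by apply/eqP; rewrite eqn_leq S_min ?S'_min //;
  [apply: szf_set_zf_set | apply: zf_set_szf_set].
Qed.
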